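(* Suppose that $G = (G,\cdot,\circ)$ is a skew brace which is the internal semidirect product of an ideal $A$ and a left ideal $B$. Define $$\varphi : (B,\circ) \rightarrow \mathrm{Aut}(A,\circ) \text{ by } \varphi_{b}(a) = b \circ a \circ \bar{b}$$ and $$\theta : (B,\cdot) \rightarrow \mathrm{Aut}(A,\cdot) \text{ by } \theta_{b}(a) = b \cdot a \cdot b^{-1}.$$ Then $A \rtimes_{\theta}^{\varphi} B$ is a skew brace and the map $\delta : G \rightarrow A \rtimes_{\theta}^{\varphi} B$ defined by $\delta(a \circ b) = (a,b)$ (for $a \in A$, $b \in B$) is an isomorphism of skew braces.
   Context: A (left) skew brace is a triple $(G,\cdot,\circ)$ in which $(G,\cdot)$ and $(G,\circ)$ are groups and $x \circ (y \cdot z) = (x \circ y) \cdot x^{-1} \cdot (x \circ z)$ for all $x,y,z \in G$, where $x^{-1}$ denotes the inverse of $x$ with respect to $\cdot$; the inverse of $x$ with respect to $\circ$ is denoted $\bar{x}$. The two groups have the same identity element $e$. The $\gamma$-function of $G$ is the homomorphism $\gamma : (G,\circ) \to \mathrm{Aut}(G,\cdot)$ given by $\gamma_x(y) = x^{-1}\cdot(x \circ y)$. A left ideal of $G$ is a subset $A \subseteq G$ that is a subgroup with respect to either operation and satisfies $\gamma_x(A)=A$ for all $x\in G$ (it is then a subgroup with respect to both operations). An ideal is a left ideal $A$ such that $(A,\cdot)\trianglelefteq (G,\cdot)$ and $(A,\circ)\trianglelefteq(G,\circ)$. A sub skew brace is a subset that is a subgroup with respect to both operations. The skew brace $G$ is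 the internal semidirect product of an ideal $A$ and a sub skew brace $B$ if $A \cap B = \{e\}$, $A \cdot B = G$ and $A \circ B = G$. For skew braces $A$, $B$ and group homomorphisms $\varphi : (B,\circ) \to \mathrm{Aut}(A,\circ)$, $\theta : (B,\cdot)\to\mathrm{Aut}(A,\cdot)$, $A \rtimes_{\theta}^{\varphi} B$ denotes the Cartesian product $A\times B$ with the operations $(a,b) \circ (a',b') = (a \circ \varphi_{b}(a'), b \circ b')$ and $(a,b) \cdot (a',b') = (a \cdot \theta_{b}(a'), b \cdot b')$. A skew brace isomorphism is a bijection respecting both operations. *)

(* Defs.v *)
From mathcomp Require Import all_boot.
From mathcomp Require Import boolp classical_sets.

Set Implicit Arguments.
Unset Strict Implicit.
Unset Printing Implicit Defensive.

Local Open Scope classical_set_scope.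

(* A skew brace carries two group laws on one carrier, so groups are given here
   as laws on a type rather than through the canonical structure groupType,
   which attaches a single law to each type (and requires a choiceType). *)
Record group_law (T : Type) := GroupLaw {
  law_op :> T -> T -> T;
  law_one : T;
  law_inv : T -> T;
  law_opA : associative law_op;
  law_op1x : left_id law_one law_op;
  law_opx1 : right_id law_one law_op;
  law_opVx : left_inverse law_one law_inv law_op;
  law_opxV : right_inverse law_one law_inv law_op }.

Record skew_brace (T : Type) := SkewBrace {
  dot : group_law T;
  circ : group_law T;
  skew_braceP : forall x y z : T,
    circ x (dot y z) = dot (dot (circ x y) (law_inv dot x)) (circ x z) }.

Definition gamma T (G : skew_brace T) (x y : T) : T :=
  dot G (law_inv (dot G) x) (circ G x y).

Record subgroup T (L : group_law T) (A : set T) : Prop := Subgroup {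
  subgroup_one : A (law_one L);
  subgroup_op : forall x y, A x -> A y -> A (L x y);
  subgroup_inv : forall x, A x -> A (law_inv L x) }.

Definition conjugate T (L : group_law T) (g x : T) : T :=
  L (L g x) (law_inv L g).

Record normal_subgroup T (L : group_law T) (A : set T) : Prop :=
  NormalSubgroup {
    normal_subgroup_subgroup : subgroup L A;
    normal_subgroup_conj : forall g x, A x -> A (conjugate L g x) }.

Record left_ideal T (G : skew_brace T) (A : set T) : Prop := LeftIdeal {
  left_ideal_subgroup : subgroup (dot G) A \/ subgroup (circ G) A;
  left_ideal_gamma : forall x, gamma G x @` A = A }.

Record ideal T (G : skew_brace T) (A : set T) : Prop := Ideal {
  ideal_left : left_ideal G A;
  ideal_dot : normal_subgroup (dot G) A;
  ideal_circ : normal_subgroup (circ G) A }.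

Record sub_skew_brace T (G : skew_brace T) (A : set T) : Prop :=
  SubSkewBrace {
    sub_skew_brace_dot : subgroup (dot G) A;
    sub_skew_brace_circ : subgroup (circ G) A }.

Lemma ideal_sub_skew_brace T (G : skew_brace T) (A : set T) :
  ideal G A -> sub_skew_brace G A.
Proof. by case=> _ [? _] [? _]; split. Qed.

Record internal_sdprod T (G : skew_brace T) (A B : set T) : Prop :=
  InternalSdprod {
    internal_sdprod_ideal : ideal G A;
    internal_sdprod_sub : sub_skew_brace G B;
    internal_sdprod_cap : A `&` B = [set law_one (dot G)];
    internal_sdprod_dot : [set dot G a b | a in A & b in B] = setT;
    internal_sdprod_circ : [set circ G a b | a in A & b in B] = setT }.

Section Restriction.
Variables (T : Type) (L : group_law T) (A : set T) (sA : subgroup L A).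

Definition sub_op (x y : A) : A :=
  SigSub (mem_set (subgroup_op sA (set_mem (valP x)) (set_mem (valP y)))).
Definition sub_one : A := SigSub (mem_set (subgroup_one sA)).
Definition sub_inv (x : A) : A :=
  SigSub (mem_set (subgroup_inv sA (set_mem (valP x)))).

Lemma sub_opA : associative sub_op.
Proof. by move=> x y z; apply: val_inj; rewrite /= law_opA. Qed.
Lemma sub_op1x : left_id sub_one sub_op.
Proof. by move=> x; apply: val_inj; rewrite /= law_op1x. Qed.
Lemma sub_opx1 : right_id sub_one sub_op.
Proof. by move=> x; apply: val_inj; rewrite /= law_opx1. Qed.
Lemma sub_opVx : left_inverse sub_one sub_inv sub_op.
Proof. by move=> x; apply: val_inj; rewrite /= law_opVx. Qed.
Lemma sub_opxV : right_inverse sub_one sub_inv sub_op.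
Proof. by move=> x; apply: val_inj; rewrite /= law_opxV. Qed.

Definition sub_law : group_law A :=
  GroupLaw sub_opA sub_op1x sub_opx1 sub_opVx sub_opxV.
End Restriction.

Section SubBrace.
Variables (T : Type) (G : skew_brace T) (A : set T).
Hypothesis sA : sub_skew_brace G A.

Lemma sub_braceP (x y z : A) :
  let c := sub_law (sub_skew_brace_circ sA) in
  let d := sub_law (sub_skew_brace_dot sA) in
  c x (d y z) = d (d (c x y) (law_inv d x)) (c x z).
Proof. by apply: val_inj; rewrite /= skew_braceP. Qed.

Definition sub_brace : skew_brace A := SkewBrace sub_braceP.
End SubBrace.

Definition conj_act T (L : group_law T) (A B : set T)
    (nA : normal_subgroup L A) (b : B) (a : A) : A :=
  SigSub (mem_set (normal_subgroup_conj nA (val b) (set_mem (valP a)))).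

Definition automorphism X (L : group_law X) (f : X -> X) : Prop :=
  bijective f /\ forall x y, f (L x y) = L (f x) (f y).

(* f is a group homomorphism from (Y, M) to Aut (X, L). *)
Definition hom_to_Aut X Y (M : group_law Y) (L : group_law X)
    (f : Y -> X -> X) : Prop :=
  (forall b, automorphism L (f b)) /\
  (forall b b' a, f (M b b') a = f b (f b' a)).

Definition sdprod_op X Y (L : group_law X) (M : group_law Y) (f : Y -> X -> X)
    (p q : X * Y) : X * Y :=
  (L p.1 (f p.2 q.1), M p.2 q.2).

(* Units and inverses of S are not constrained here: the operations determine
   them. *)
Definition is_sdprod X Y (SA : skew_brace X) (SB : skew_brace Y)
    (theta phi : Y -> X -> X) (S : skew_brace (X * Y)) : Prop :=
  (forall p q, dot S p q = sdprod_op (dot SA) (dot SB) theta p q) /\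
  (forall p q, circ S p q = sdprod_op (circ SA) (circ SB) phi p q).

Definition brace_iso X Y (G : skew_brace X) (H : skew_brace Y) (f : X -> Y) :
    Prop :=
  [/\ bijective f,
      forall x y, f (dot G x y) = dot H (f x) (f y) &
      forall x y, f (circ G x y) = circ H (f x) (f y)].

(* Main.v *)
Require Import Defs.
From mathcomp Require Import all_boot.
From mathcomp Require Import boolp classical_sets.

(** For a in A and b in B one has a o b = a . b.  Indeed a o b = a . gamma_a(b)
    with gamma_a(b) in B, and also a o b = b o a' = b . gamma_b(a') = a'' . b
    with a', a'' in A, so gamma_a(b) = b by uniqueness of the decomposition in
    the dot group.  Hence (a, b) |-> a o b = a . b is at once the decomposition
    of both groups as semidirect products, and the skew brace structure on
    A x B is the one transported along this bijection. *)

Set Implicit Arguments.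
Unset Strict Implicit.
Unset Printing Implicit Defensive.

Local Open Scope classical_set_scope.

Section GroupLaw.
Variables (T : Type) (L : group_law T).
Local Notation "1" := (law_one L).
Local Notation inv := (law_inv L).

Lemma law_opK x : cancel (L x) (L (inv x)).
Proof. by move=> y; rewrite law_opA law_opVx law_op1x. Qed.

Lemma law_opKV x : cancel (L (inv x)) (L x).
Proof. by move=> y; rewrite law_opA law_opxV law_op1x. Qed.

Lemma law_op_injl x : injective (L x).
Proof. exact: can_inj (law_opK x). Qed.

Lemma law_op_injr x : injective (L^~ x).
Proof.
by move=> y z /(congr1 (L^~ (inv x))); rewrite /= -!law_opA law_opxV !law_opx1.
Qed.

Lemma law_inv_uniq x y : L x y = 1 -> inv x = y.
Proof. by move=> xy1; apply: (@law_op_injl x); rewrite xy1 law_opxV. Qed.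

Lemma law_invM x y : inv (L x y) = L (inv y) (inv x).
Proof. by apply: law_inv_uniq; rewrite -law_opA law_opKV law_opxV. Qed.

Lemma law_invK : involutive inv.
Proof. by move=> x; apply: law_inv_uniq; rewrite law_opVx. Qed.

Lemma conjugateM g x y :
  conjugate L g (L x y) = L (conjugate L g x) (conjugate L g y).
Proof. by rewrite /conjugate -!law_opA law_opK. Qed.

Lemma conjugate_op g h x :
  conjugate L (L g h) x = conjugate L g (conjugate L h x).
Proof. by rewrite /conjugate law_invM !law_opA. Qed.

Lemma conjugateK g : cancel (conjugate L g) (conjugate L (inv g)).
Proof.
move=> x; rewrite -conjugate_op law_opVx /conjugate law_op1x.
by rewrite (law_inv_uniq (law_op1x L 1)) law_opx1.
Qed.

Lemma conjugateKV g : cancel (conjugate L (inv g)) (conjugate L g).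
Proof. by move=> x; rewrite -{1}[g]law_invK conjugateK. Qed.

Lemma conjugate_mul g x : L (conjugate L g x) g = L g x.
Proof. by rewrite /conjugate -!law_opA law_opVx law_opx1. Qed.

(** Moving [b] past [a'] conjugates [a']: this is the semidirect product rule, read inside the group
    itself. *)
Lemma mul_sdprod a b a' b' :
  L (L a b) (L a' b') = L (L a (conjugate L b a')) (L b b').
Proof.
by rewrite -[RHS]law_opA [L _ (L b b')]law_opA conjugate_mul !law_opA.
Qed.

Variables A B : set T.
Hypotheses (sA : subgroup L A) (sB : subgroup L B).

(** The quotient [a'^-1 a = b' b^-1] lies in both [A] and [B], hence is trivial. *)
Lemma op_decomp_inj a b a' b' : A `&` B `<=` [set 1] ->
  A a -> B b -> A a' -> B b' -> L a b = L a' b' -> a = a' /\ b = b'.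
Proof.
move=> AB1 Aa Bb Aa' Bb' ab.
have eq_quo : L (inv a') a = L b' (inv b).
  apply: (@law_op_injr b); rewrite -law_opA ab law_opK.
  by rewrite -law_opA law_opVx law_opx1.
have quo1 : L (inv a') a = 1.
  apply: AB1; split; first exact/(subgroup_op sA)/Aa/(subgroup_inv sA).
  by rewrite eq_quo; apply/(subgroup_op sB)/(subgroup_inv sB).
have eq_a : a = a' by apply: (@law_op_injl (inv a')); rewrite quo1 law_opVx.
by split=> //; apply: (@law_op_injl a); rewrite ab eq_a.
Qed.

(** Stated for an arbitrary law so as to serve both [phi] and [theta]; conjugation by [b^-1]
    provides the inverse of each automorphism. *)
Lemma conj_act_hom (nA : normal_subgroup L A) :
  hom_to_Aut (sub_law sB) (sub_law sA) (conj_act nA (B := B)).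
Proof.
split=> [b|b b' a]; last by apply: val_inj; rewrite /= conjugate_op.
split=> [|x y]; last by apply: val_inj; rewrite /= conjugateM.
exists (conj_act nA (sub_inv sB b)) => a; apply: val_inj.
  exact: conjugateK.
exact: conjugateKV.
Qed.

End GroupLaw.

Section Transport.
Variables (T U : Type) (f : T -> U) (g : U -> T).
Hypotheses (fK : cancel f g) (gK : cancel g f).

Definition transport_op (L : group_law T) (x y : U) : U := f (L (g x) (g y)).

Lemma transport_law_subproof (L : group_law T) :
  [/\ associative (transport_op L), left_id (f (law_one L)) (transport_op L),
      right_id (f (law_one L)) (transport_op L),
      left_inverse (f (law_one L)) (f \o law_inv L \o g) (transport_op L) &
      right_inverse (f (law_one L)) (f \o law_inv L \o g) (transport_op L)].
Proof.
split=> [x y z|x|x|x|x]; rewrite /transport_op /= !fK.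
- by rewrite law_opA.
- by rewrite law_op1x gK.
- by rewrite law_opx1 gK.
- by rewrite law_opVx.
- by rewrite law_opxV.
Qed.

Definition transport_law (L : group_law T) : group_law U :=
  let: And5 opA op1x opx1 opVx opxV := transport_law_subproof L in
  GroupLaw opA op1x opx1 opVx opxV.

(** The match on the opaque [transport_law_subproof] blocks computation, so the operation and the
    inverse are exposed by rewriting rules. *)
Lemma transport_lawE (L : group_law T) x y :
  transport_law L x y = f (L (g x) (g y)).
Proof. by rewrite /transport_law; case: transport_law_subproof. Qed.

Lemma transport_law_inv (L : group_law T) x :
  law_inv (transport_law L) x = f (law_inv L (g x)).
Proof. by rewrite /transport_law; case: transport_law_subproof. Qed.

Lemma transport_braceP (G : skew_brace T) (x y z : U) :
  let c := transport_law (circ G) in let d := transport_law (dot G) in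
  c x (d y z) = d (d (c x y) (law_inv d x)) (c x z).
Proof. by rewrite /= !(transport_lawE, transport_law_inv, fK) skew_braceP. Qed.

Definition transport_brace (G : skew_brace T) : skew_brace U :=
  SkewBrace (transport_braceP G).

Lemma transport_brace_iso (G : skew_brace T) :
  brace_iso G (transport_brace G) f.
Proof.
by split=> [|x y|x y]; [exists g | |]; rewrite ?transport_lawE ?fK.
Qed.

End Transport.

Section SkewBrace.
Variables (T : Type) (G : skew_brace T).

Lemma circ_gamma x y : circ G x y = dot G x (gamma G x y).
Proof. by rewrite /gamma law_opKV. Qed.

(** At [x = e], the unit of [circ], and [y = z = 1], that of [dot], the brace identity collapses to
    [1 = e^-1]. *)
Lemma law_one_circ : law_one (circ G) = law_one (dot G).
Proof.
set e := law_one (circ G); set d := dot G.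
have einv : law_inv d e = law_one d.
  have := skew_braceP G e (law_one d) (law_one d).
  by rewrite !law_op1x !law_opx1.
by rewrite -[e](law_opx1 d) -einv law_opxV.
Qed.

Lemma left_ideal_gamma_mem (A : set T) x a :
  left_ideal G A -> A a -> A (gamma G x a).
Proof. by move=> lA Aa; rewrite -(left_ideal_gamma lA x); exists a. Qed.

Lemma circ_eq_dot (A B : set T) a b :
  internal_sdprod G A B -> left_ideal G B ->
  A a -> B b -> circ G a b = dot G a b.
Proof.
move=> [[lA nAd nAc] sB AB1 _ _] lB Aa Bb.
(* Chosen so that [a o b = b o a']; it stays in [A] by normality for [circ]. *)
pose a' := conjugate (circ G) (law_inv (circ G) b) a.
have Aa' : A a' by apply: normal_subgroup_conj.
have ab : circ G a b = dot G (conjugate (dot G) b (gamma G b a')) b.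
  rewrite conjugate_mul -circ_gamma.
  by rewrite -(conjugate_mul (circ G) b a') conjugateKV.
have Aconj : A (conjugate (dot G) b (gamma G b a')).
  by apply: normal_subgroup_conj => //; apply: left_ideal_gamma_mem.
(* The decomposition [ab] is compared with [a o b = a . gamma_a(b)]; [gamma_a(b)] is in [B] because
   [B] is a left ideal. *)
have [||_ bE] := op_decomp_inj (normal_subgroup_subgroup nAd)
  (sub_skew_brace_dot sB) _ Aconj Bb Aa (left_ideal_gamma_mem a lB Bb).
- by rewrite AB1.
- by rewrite -ab circ_gamma.
- by rewrite circ_gamma -bE.
Qed.

(** Since [A o B = G], choice gives a section [delta] of [(a, b) |-> a o b]; uniqueness of
    decompositions in the [circ] group makes it a two-sided inverse. *)
Lemma sdprod_bij (A B : set T) : internal_sdprod G A B ->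
  exists delta : T -> A * B,
    cancel delta (fun p => circ G (val p.1) (val p.2)) /\
    cancel (fun p => circ G (val p.1) (val p.2)) delta.
Proof.
move=> [[_ _ nA] sB AB1 _ ABT].
have decomp g : exists p : A * B, circ G (val p.1) (val p.2) = g.
  have : setT g by [].
  rewrite -ABT => -[a Aa [b Bb <-]].
  by exists (SigSub (mem_set Aa), SigSub (mem_set Bb)).
have [delta deltaK] := choice decomp.
exists delta; split=> // -[a b] /=.
have [] := op_decomp_inj (normal_subgroup_subgroup nA)
  (sub_skew_brace_circ sB) _ (set_mem (valP (delta (circ G (val a) (val b))).1))
  (set_mem (valP (delta (circ G (val a) (val b))).2))
  (set_mem (valP a)) (set_mem (valP b)) (deltaK _).
  by rewrite AB1 law_one_circ.
by case: (delta _) => a' b' /= /val_inj-> /val_inj->.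
Qed.

End SkewBrace.

(* The existence and uniqueness of delta say that delta (a o b) = (a, b)
   is a well-posed definition of a map on the whole of G. *)
Theorem proposition3p3 (T : Type) (G : skew_brace T) (A B : set T)
    (hG : internal_sdprod G A B) (hB : left_ideal G B) :
  let hA := internal_sdprod_ideal hG in
  let SA : skew_brace A := sub_brace (ideal_sub_skew_brace hA) in
  let SB : skew_brace B := sub_brace (internal_sdprod_sub hG) in
  let phi : B -> A -> A := conj_act (ideal_circ hA) in
  let theta : B -> A -> A := conj_act (ideal_dot hA) in
  hom_to_Aut (circ SB) (circ SA) phi /\
  hom_to_Aut (dot SB) (dot SA) theta /\
  exists S : skew_brace (A * B),
    is_sdprod SA SB theta phi S /\
    exists delta : T -> A * B,
      (forall (a : A) (b : B), delta (circ G (val a) (val b)) = (a, b)) /\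
      (forall delta' : T -> A * B,
        (forall (a : A) (b : B), delta' (circ G (val a) (val b)) = (a, b)) ->
        forall g : T, delta' g = delta g) /\
      brace_iso G S delta.
Proof.
move=> hA SA SB phi theta.
split; first exact: conj_act_hom.
split; first exact: conj_act_hom.
have [delta [deltaK muK]] := sdprod_bij hG.
(* With the structure transported along [delta], the brace axioms and the isomorphism are automatic;
   only the two product formulas need the hypotheses on [A] and [B]. *)
exists (transport_brace deltaK muK G); split; last first.
  exists delta; split=> [a b|]; first exact: (muK (a, b)).
  split=> [delta' delta'E g|]; last exact: transport_brace_iso.
  by rewrite -[in LHS](deltaK g) delta'E; case: (delta g).
have mu_dot (p : A * B) :
    circ G (val p.1) (val p.2) = dot G (val p.1) (val p.2).
  exact: circ_eq_dot hG hB (set_mem (valP _)) (set_mem (valP _)).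
(* Both formulas are checked in [G] after applying the inverse of [delta]; for [dot], [mu_dot] first
   turns each [a o b] into [a . b]. *)
split=> p q; rewrite /= transport_lawE; apply: (can_inj muK).
  by rewrite deltaK !mu_dot mul_sdprod.
by rewrite deltaK mul_sdprod.
Qed.
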